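(* Let $L=(M_1,\dots,M_n)$. Then the $\mathbb{F}_p[z_1^p,\dots,z_n^p]$-module $\mathcal{M}_L$ of all $L$-admissible polynomial solutions of the KZ system over $\mathbb{F}_p$ coincides with the module $\mathcal{M}=\{\sum_{l=1}^r c_l(z)I^{[l]}(z):\ c_l\in\mathbb{F}_p[z_1^p,\dots,z_n^p]\}$ of $\mathbb{F}_p$-hypergeometric solutions.
   Context: Let $p,q$ be primes and $n$ a positive integer with $p>n\ge2$, $p>q$. Fix positive integers $m_1,\dots,m_n<q$. For $i\ne j$ let $\Omega_{ij}$ be the $n\times n$ matrix whose only nonzero entries are $(\Omega_{ij})_{ii}=-m_j$, $(\Omega_{ij})_{ij}=m_j$, $(\Omega_{ij})_{ji}=m_i$, $(\Omega_{ij})_{jj}=-m_i$. A polynomial solution of the KZ system over $\mathbb{F}_p$ is $I(z)=(I_1,\dots,I_n)\in\mathbb{F}_p[z_1,\dots,z_n]^n$ with $\partial I/\partial z_i=q^{-1}\sum_{j\ne i}\Omega_{ij}I/(z_i-z_j)$ for all $i$ and $\sum_im_iI_i=0$ (computed in $\mathbb{F}_p$). $M_i$ is the least positive integer with $M_i\equiv -m_iq^{-1}\pmod p$. With $\Phi_p(x,z)=\prod_i(x-z_i)^{M_i}$, $I^{[l]}(z)$ is the coefficient of $x^{lp-1}$ in $(\Phi_p/(x-z_1),\dots,\Phi_p/(x-z_n))$, and $r=\lfloor\sum_iM_i/p\rfloor$. For $L=(L_1,\dots,L_n)\in\mathbb{Z}_{\ge0}^n$, a polynomial vector $I(z)$ is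 $L$-admissible if $\partial^{L_j+1}I/\partial z_j^{L_j+1}=0$ for $j=1,\dots,n$. *)

(* Defs.v *)
From HB Require Import structures.
From mathcomp Require Import all_boot all_order all_algebra.
From mathcomp Require Export mpoly.
Set Implicit Arguments. Unset Strict Implicit. Unset Printing Implicit Defensive.
Import Order.TTheory GRing.Theory Num.Theory.
Local Open Scope ring_scope.

Notation Fpoly p n := {mpoly 'F_p[n]}.
Notation pvec p n := ('I_n -> {mpoly 'F_p[n]}).

Definition Omega (p n : nat) (m : 'I_n -> nat) (i j k l : 'I_n) : 'F_p :=
  if (k == i) && (l == i) then - (m j)%:R
  else if (k == i) && (l == j) then (m j)%:R
  else if (k == j) && (l == i) then (m i)%:R
  else if (k == j) && (l == j) then - (m i)%:R
  else 0.

Definition OmegaI p n (m : 'I_n -> nat) (i j : 'I_n) (I : pvec p n) (k : 'I_n)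
  : Fpoly p n :=
  \sum_(l < n) (Omega p m i j k l)%:MP * I l.

(* KZ system over F_p, with denominators cleared: for each i, multiplying
   dI/dz_i = q^{-1} sum_{j<>i} Omega_ij I / (z_i - z_j) by
   D_i = prod_{j<>i} (z_i - z_j) (a nonzero polynomial in the domain
   F_p[z]); plus the linear condition sum_i m_i I_i = 0. *)
Definition KZ_solution (p q n : nat) (m : 'I_n -> nat) (I : pvec p n) : Prop :=
  (forall i k : 'I_n,
     (\prod_(j < n | j != i) ('X_i - 'X_j)) * mderiv i (I k)
     = (q%:R : 'F_p)^-1 *:
         \sum_(j < n | j != i)
            (\prod_(j' < n | (j' != i) && (j' != j)) ('X_i - 'X_j'))
              * OmegaI m i j I k)
  /\ \sum_(i < n) (m i)%:R *: I i = 0.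

Definition admissible p n (L : 'I_n -> nat) (I : pvec p n) : Prop :=
  forall j k : 'I_n, iter (L j).+1 (mderiv j) (I k) = 0.

Definition in_Frob_subring p n (c : Fpoly p n) : Prop :=
  exists c' : Fpoly p n, c = comp_mpoly [tuple ('X_i : Fpoly p n) ^+ p | i < n] c'.

(* I^{[l]}(z)_i = coefficient of x^{lp-1} in Phi_p(x,z)/(x - z_i), where
   Phi_p(x,z) = prod_k (x - z_k)^{M_k}; since M_i >= 1 this quotient is
   (x - z_i)^{M_i - 1} * prod_{k<>i} (x - z_k)^{M_k}. *)
Definition Ihyp p n (M : 'I_n -> nat) (l : nat) (i : 'I_n) : Fpoly p n :=
  ((('X - ('X_i)%:P) ^+ (M i).-1
     * \prod_(k < n | k != i) ('X - ('X_k)%:P) ^+ (M k)) : {poly Fpoly p n})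
  `_(l * p - 1).

(* Main.v *)
(* Comparing coefficients, the KZ system becomes two-term relations between the
   coefficients of I at neighbouring exponents of the same total degree.
   Admissibility confines each exponent modulo p to the box [0, M_j], where
   M_j + 1 < p because m_j < q; hence the relations never leave a block
   p c + [0, M].  Within a block and a fixed degree they determine all
   coefficients from a single one, and the linear condition forces that degree,
   relative to p c, to be sum M_j - l p with 1 <= l <= r, exactly where
   z^(p c) I^[l] lives.  Subtracting a multiple of z^(p c) I^[l] kills the whole
   block in that degree, and one concludes by induction on the support. *)
Require Import Defs.
From HB Require Import structures.
From mathcomp Require Import all_boot all_order all_algebra.
From mathcomp Require Import mpoly zify ring.
Import Order.TTheory GRing.Theory Num.Theory.
Set Implicit Arguments.
Unset Strict Implicit.
Unset Printing Implicit Defensive.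
Local Open Scope ring_scope.

(** * Reduction of the KZ system to its off-diagonal equations *)

(* The equations for [dI_k/dz_i] with [i <> k]; the one for [dI_i/dz_i] follows
   by differentiating the linear condition. *)
Definition KZ_reduced (F : fieldType) n (mu : 'I_n -> F)
    (I : 'I_n -> {mpoly F[n]}) : Prop :=
  (forall i k, i != k -> ('X_i - 'X_k) * (I k)^`M(i) = mu i *: (I k - I i))
  /\ \sum_i mu i *: I i = 0.

Lemma mpolyX_neq (F : fieldType) n (i j : 'I_n) :
  i != j -> 'X_i - 'X_j != 0 :> {mpoly F[n]}.
Proof.
move=> ij; rewrite subr_eq0; apply/eqP => /(congr1 (mcoeff U_(i)%MM)).
rewrite !mcoeffXU eqxx eq_sym (negbTE ij).
by move/eqP; rewrite oner_eq0.
Qed.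

Lemma OmegaI_diag p n (m : 'I_n -> nat) (i j : 'I_n) (I : pvec p n) :
  i != j -> OmegaI m i j I i = (m j)%:R *: (I j - I i).
Proof.
move=> ij; rewrite /OmegaI (bigD1 i) //= (bigD1 j) /=; last by rewrite eq_sym.
rewrite big1 ?addr0 => [|l /andP[li lj]]; last first.
  by rewrite /Omega eqxx (negbTE li) (negbTE lj) (negbTE ij) /= mpolyC0 mul0r.
rewrite /Omega !eqxx /= eq_sym (negbTE ij) /= !mul_mpolyC.
by rewrite scaleNr scalerBr addrC.
Qed.

Lemma OmegaI_offdiag p n (m : 'I_n -> nat) (i j : 'I_n) (I : pvec p n) :
  i != j -> OmegaI m i j I j = (m i)%:R *: (I i - I j).
Proof.
move=> ij; rewrite /OmegaI (bigD1 i) //= (bigD1 j) /=; last by rewrite eq_sym.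
rewrite big1 ?addr0 => [|l /andP[li lj]]; last first.
  rewrite /Omega eqxx (negbTE li) (negbTE lj) /= !andbF /=.
  by rewrite mpolyC0 mul0r.
rewrite /Omega !eqxx /= eq_sym (negbTE ij) /= !mul_mpolyC.
by rewrite scaleNr scalerBr.
Qed.

Lemma OmegaI_out p n (m : 'I_n -> nat) (i j k : 'I_n) (I : pvec p n) :
  k != i -> k != j -> OmegaI m i j I k = 0.
Proof.
move=> ki kj; rewrite /OmegaI big1 // => l _.
by rewrite /Omega (negbTE ki) (negbTE kj) /= mpolyC0 mul0r.
Qed.

(** For [k != i], row [k] of [Omega_ij] vanishes unless [j = k], so the sum collapses to one term
    and the common product of differences cancels in a domain. The constant left over, [- m_i / q],
    is [mu i]. *)
Lemma KZ_solution_reduced p q n (m : 'I_n -> nat) (mu : 'I_n -> 'F_p)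
    (I : pvec p n) :
  (q%:R : 'F_p) != 0 -> (forall i, mu i = - (m i)%:R / q%:R) ->
  (forall i, mu i != 0) ->
  KZ_solution q m I <-> KZ_reduced mu I.
Proof.
move=> q0 muE mu0.
have mE i : (m i)%:R = - (q%:R * mu i) :> 'F_p.
  by rewrite muE mulrC mulfVK // opprK.
have sumE : \sum_(i < n) (m i)%:R *: I i = - q%:R *: \sum_i mu i *: I i.
  by rewrite scaler_sumr; apply: eq_bigr => i _; rewrite scalerA mE mulNr.
have offdiag i k : i != k ->
    q%:R^-1 *: \sum_(j < n | j != i)
      (\prod_(j' < n | (j' != i) && (j' != j)) ('X_i - 'X_j'))
        * OmegaI m i j I k
    = (\prod_(j' < n | (j' != i) && (j' != k)) ('X_i - 'X_j'))
        * (mu i *: (I k - I i)).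
  move=> ik; rewrite (bigD1 k) /=; last by rewrite eq_sym.
  rewrite [X in _ *: (_ + X)]big1 ?addr0; last first.
    by move=> j /andP[ji jk]; rewrite OmegaI_out ?mulr0 // eq_sym.
  rewrite OmegaI_offdiag // scalerAr; congr (_ * _).
  by rewrite mE scalerA mulrN mulKf // scaleNr -scalerN opprB.
have prodE i k : i != k -> \prod_(j < n | j != i) ('X_i - 'X_j)
    = (\prod_(j < n | (j != i) && (j != k)) ('X_i - 'X_j)) * ('X_i - 'X_k)
    :> Fpoly p n.
  by move=> ik; rewrite (bigD1 k) /= 1?mulrC // eq_sym.
have prod0 i (P : pred 'I_n) :
    \prod_(j < n | (j != i) && P j) ('X_i - 'X_j) != 0 :> Fpoly p n.
  by apply/prodf_neq0 => j /andP[ji _]; apply: mpolyX_neq; rewrite eq_sym.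
split=> [[h1 h2]|[h1 h2]].
  split=> [i k ik|]; last first.
    move/eqP: h2; rewrite sumE scaler_eq0 oppr_eq0 (negbTE q0) /=.
    by move/eqP.
  apply: (mulfI (prod0 i (fun j => j != k))).
  by rewrite mulrA -prodE // h1 offdiag.
split; last by rewrite sumE h2 scaler0.
move=> i k; have [<-|ik] := eqVneq i k; last first.
  by rewrite offdiag // (prodE i k ik) -mulrA h1.
have dsum : mu i *: (I i)^`M(i) = - \sum_(j | j != i) mu j *: (I j)^`M(i).
  have := congr1 (mderiv i) h2; rewrite mderiv0 raddf_sum (bigD1 i) //=.
  rewrite mderivZ => /eqP; rewrite addr_eq0 => /eqP->; congr (- _).
  by apply: eq_bigr => j _; rewrite mderivZ.
(* Multiplying by the nonzero [mu i] lets [dsum] trade the diagonal derivative for off-diagonal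
   ones; the two sums then agree term by term. *)
apply: (scalerI (mu0 i)); rewrite scalerAr dsum mulrN mulr_sumr -sumrN.
rewrite scalerA mulrC -scalerA !scaler_sumr; apply: eq_bigr => j ji.
have ij : i != j by rewrite eq_sym.
rewrite (prodE i j ij) OmegaI_diag // -scalerAr -mulrA h1 //.
rewrite -!scalerAr !scalerA mE.
suff -> : q%:R^-1 * mu i * - (q%:R * mu j) = - (mu j * mu i) by rewrite scaleNr.
by field.
Qed.

(** * Two-term relations between coefficients of a solution *)

Lemma mcoeffMXE (R : nzRingType) n (m a : 'X_{1..n}) (f : {mpoly R[n]}) :
  (f * 'X_[m])@_a = if (m <= a)%MM then f@_(a - m) else 0.
Proof.
case: ifPn => [ma|nma]; first by rewrite -{1}(submK ma) addmC mcoeffMX.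
apply: memN_msupp_eq0; rewrite (perm_mem (msuppMX f m)); apply/mapP => -[b _ E].
by case/negP: nma; rewrite E; apply: lem_addr.
Qed.

Lemma mcoeff_euler (R : comNzRingType) n (i : 'I_n) (a : 'X_{1..n})
    (f : {mpoly R[n]}) :
  ('X_i * f^`M(i))@_a = (a i)%:R * f@_a.
Proof.
rewrite mulrC mcoeffMXE; case: ifPn => [ua|].
  rewrite mcoeff_mderiv (submK ua) mnmBE mnm1E eqxx subn1 prednK ?mulr_natl //.
  by have /mnm_lepP/(_ i) := ua; rewrite mnm1E eqxx.
move=> nua; suff -> : a i = 0%N by rewrite mul0r.
apply/eqP; rewrite -leqn0 leqNgt; apply: contra nua => ai.
by apply/mnm_lepP => j; rewrite mnm1E; case: eqP => // <-.
Qed.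

(** The equations for [(i, k)] and [(k, i)] have proportional right-hand sides, and the common
    factor ['X_i - 'X_k] cancels. This says that the 1-form with components [mu k *: I k] is
    closed. *)
Lemma KZ_closed (F : fieldType) n (mu : 'I_n -> F) (I : 'I_n -> {mpoly F[n]})
    (i k : 'I_n) :
  KZ_reduced mu I -> mu k *: (I k)^`M(i) = mu i *: (I i)^`M(k).
Proof.
have [->//|ik] := eqVneq i k; case=> h _.
have ki : k != i by rewrite eq_sym.
apply: (mulfI (mpolyX_neq F ik)); rewrite -scalerAr h // -scalerAr.
rewrite -[X in _ = _ *: (X * _)]opprB mulNr h // -scalerN opprB !scalerA mulrC //.
Qed.

Lemma KZ_mcoeff_closed (F : fieldType) n (mu : 'I_n -> F)
    (I : 'I_n -> {mpoly F[n]}) (i k : 'I_n) (a : 'X_{1..n}) :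
  KZ_reduced mu I ->
  mu k * (a i).+1%:R * (I k)@_(a + U_(i))
  = mu i * (a k).+1%:R * (I i)@_(a + U_(k)).
Proof.
move=> /(KZ_closed i k)/(congr1 (mcoeff a)).
rewrite !mcoeffZ !mcoeff_mderiv.
by rewrite -[(I k)@__ *+ _]mulr_natl -[(I i)@__ *+ _]mulr_natl !mulrA.
Qed.

(** Closedness turns the part ['X_k * (I k)^]M(i)[of the equation into]'X_k * (I i)^[M(k)], up to
    scalars. Only Euler operators remain; they are diagonal on monomials, so the relation stays at a
    single exponent. *)
Lemma KZ_mcoeff_ratio (F : fieldType) n (mu : 'I_n -> F)
    (I : 'I_n -> {mpoly F[n]}) (i k : 'I_n) (a : 'X_{1..n}) :
  KZ_reduced mu I ->
  mu k * (mu i - (a i)%:R) * (I k)@_a = mu i * (mu k - (a k)%:R) * (I i)@_a.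
Proof.
have [->//|ik] := eqVneq i k => h.
have E : mu k *: (mu i *: I k - 'X_i * (I k)^`M(i))
         = mu i *: (mu k *: I i - 'X_k * (I i)^`M(k)).
  have := congr1 ( *:%R (mu k)) (h.1 i k ik).
  rewrite mulrBl !scalerBr !scalerAr (KZ_closed i k h) -!scalerAr !scalerA.
  rewrite [mu k * mu i]mulrC => /eqP; rewrite subr_eq => /eqP ->.
  by rewrite opprD opprB addrA addrCA subrr addr0.
move/(congr1 (mcoeff a)): E; rewrite !(mcoeffZ, mcoeffB, mcoeff_euler).
by rewrite -!mulrBl !mulrA.
Qed.

(** * Propagation of zeros inside a box of exponents *)

Lemma mnm_le_mdeg_eq n (a b : 'X_{1..n}) :
  (a <= b)%MM -> mdeg b = mdeg a -> b = a.
Proof.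
move=> ab; rewrite -{1}(submK ab) mdegD => /eqP.
rewrite -{2}[mdeg a]add0n eqn_add2r mdeg_eq0 => /eqP E.
by rewrite -(submK ab) E add0m.
Qed.

Lemma mnm_exchange n (a b : 'X_{1..n}) :
  mdeg a = mdeg b -> a != b ->
  exists i k, [/\ i != k, (b i < a i)%N & (a k < b k)%N].
Proof.
move=> d ab.
have gt (x y : 'X_{1..n}) : mdeg x = mdeg y -> x != y ->
    exists i, (y i < x i)%N.
  move=> xy nxy; apply/existsP; apply: contraNT nxy => /existsPn h.
  apply/eqP; apply/esym/(@mnm_le_mdeg_eq n x y) => //.
  by apply/mnm_lepP => i; rewrite leqNgt h.
have [i hi] := gt _ _ d ab.
have [k hk] : exists k, (a k < b k)%N by apply: gt; rewrite // eq_sym.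
by exists i, k; split=> //; apply/eqP => E; subst k; lia.
Qed.

(* The second relation carries the vanishing of one component at [a] to all
   components, the first carries it to the exponent [a - U_(i) + U_(k)]; such
   moves connect the exponents of a given total degree in the box [0, M]. *)
Lemma zero_class (F : fieldType) n (M : 'I_n -> nat)
    (v : 'I_n -> 'X_{1..n} -> F) :
  (forall i x, (0 < x <= M i)%N -> x%:R != 0 :> F) ->
  (forall i, 0 < M i)%N ->
  (forall i k (a : 'X_{1..n}), (M k)%:R * (a i).+1%:R * v k (a + U_(i))%MM
                 = (M i)%:R * (a k).+1%:R * v i (a + U_(k))%MM) ->
  (forall i k (a : 'X_{1..n}), (M k)%:R * ((M i)%:R - (a i)%:R) * v k a
                 = (M i)%:R * ((M k)%:R - (a k)%:R) * v i a) ->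
  forall (b0 b : 'X_{1..n}) k0, (forall j, b0 j <= M j)%N -> (forall j, b j <= M j)%N ->
    mdeg b0 = mdeg b -> (b0 k0 < M k0)%N -> v k0 b0 = 0 -> forall k, v k b = 0.
Proof.
move=> natF M0 R0 R1.
(* Since [0 < M k - a k <= M k], the multiplier of [v i a] in [R1] is nonzero. *)
have spread (a : 'X_{1..n}) k : (a k < M k)%N -> v k a = 0 -> forall i, v i a = 0.
  move=> ak vk i; have := R1 i k a; rewrite vk mulr0 => /esym/eqP.
  rewrite !mulf_eq0 -natrB ?(ltnW ak) // (negbTE (natF i _ _)) ?M0 //=.
  by rewrite (negbTE (natF k _ _)) ?subn_gt0 ?ak ?leq_subr //= => /eqP.
move=> b0 b k0 b0M bM bb b0k0 /(spread _ _ b0k0) {b0k0 k0}.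
(* Truncated subtraction makes this measure count only the excess of [b0] over [b]; each unit moved
   from [i] to [l] lowers it by one. *)
have [s] := ubnP (\sum_j (b0 j - b j))%N.
elim: s => // s IH in b0 b0M bb * => hs v0 k.
have [<-//|nb] := eqVneq b0 b.
have [i [l [il bi bl]]] := mnm_exchange bb nb.
pose a := (b0 - U_(i))%MM.
have aE j : a j = (b0 j - (i == j))%N by rewrite mnmBE mnm1E.
have aU : (a + U_(i))%MM = b0.
  by apply: submK; apply/mnm_lepP => j; rewrite mnm1E; case: eqP => // <-; lia.
have alE : a l = b0 l by rewrite aE (negbTE il) subn0.
have aiE : a i = (b0 i).-1 by rewrite aE eqxx subn1.
pose b1 := (a + U_(l))%MM.
have b1E j : b1 j = (a j + (l == j))%N by rewrite mnmDE mnm1E.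
have b1M j : (b1 j <= M j)%N.
  rewrite b1E aE; have := b0M j; have := bM j.
  by case: (eqVneq l j) => [<-|] /=; lia.
(* The multiplier [(a l).+1] is nonzero because [a l = b0 l < b l <= M l]. *)
have v1 : v i b1 = 0.
  have := R0 i l a; rewrite aU v0 mulr0 => /esym/eqP.
  rewrite !mulf_eq0 (negbTE (natF i _ _)) ?M0 //= (negbTE (natF l _ _)) ?alE.
    by move/eqP.
  by have := bM l; lia.
(* Coordinate [i] has just lost a unit, so [spread] applies again, now from component [i]. *)
have b1i : (b1 i < M i)%N.
  by rewrite b1E aiE eq_sym (negbTE il); have := b0M i; lia.
apply: (IH b1) => //; last exact: spread v1.
  by rewrite -bb -aU /b1 !mdegD !mdeg1.
move: hs; rewrite ltnS; apply: leq_trans.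
rewrite [X in (X < _)%N](bigD1 i) // [X in (_ < X)%N](bigD1 i) //=.
rewrite -addSn leq_add //.
  by rewrite b1E aiE eq_sym (negbTE il); lia.
by apply: leq_sum => j ji; rewrite b1E aE; case: (eqVneq l j) => [<-|] /=; lia.
Qed.

(** * Coefficients of a product of powers of [x - z_i] *)

(** After binomial expansion of every factor, a monomial in the [z_i] arises from exactly one choice
    of terms, and homogeneity then fixes the power of [x]. *)
Lemma prod_XsubX_coef (R : comNzRingType) n (N : 'I_n -> nat) (s : nat)
    (b : 'X_{1..n}) :
  ((\prod_(i < n) ('X - ('X_i)%:P) ^+ N i : {poly {mpoly R[n]}})`_s)@_b
  = if (mdeg b + s == \sum_i N i)%N
    then \prod_(i < n) ((-1) ^+ b i *+ 'C(N i, b i)) else 0.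
Proof.
pose K := \sum_i N i; pose a i j : R := (-1) ^+ j *+ 'C(N i, j).
have NK i : (N i <= K)%N by rewrite /K (bigD1 i) //= leq_addr.
(* All expansions are padded to the common range [K.+1], so that one type of finite functions
   indexes the distributed product; the padding terms have zero binomials. *)
have factorE i : ('X - ('X_i)%:P) ^+ N i
    = \sum_(j < K.+1) (a i j *: 'X_i ^+ j) *: 'X^(N i - j)
    :> {poly {mpoly R[n]}}.
  rewrite exprBn (big_ord_widen K.+1 (fun j => (-1) ^+ j * 'X^(N i - j)
     * ('X_i)%:P ^+ j *+ 'C(N i, j))) ?ltnS // big_mkcond /=.
  apply: eq_bigr => j _; rewrite /a; case: ltnP => [_|Nj]; last first.
    by rewrite bin_small // mulr0n !scale0r.
  rewrite -scalerMnl -scalerMnl; congr (_ *+ _).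
  rewrite -signr_odd -[X in (X *: _) *: _]signr_odd -polyC_exp mulrAC mulrC.
  case: (odd j); rewrite ?expr1 ?expr0 ?scaleN1r ?scale1r ?mul1r.
    by rewrite scaleNr -mul_polyC mulN1r mulrN mulrC.
  by rewrite -mul_polyC mulrC.
have termE (f : {ffun 'I_n -> 'I_K.+1}) :
    ((\prod_i ((a i (f i) *: 'X_i ^+ f i) *: 'X^(N i - f i)
       : {poly {mpoly R[n]}}))`_s)@_b
    = (\prod_i a i (f i)) * ([multinom (f i : nat) | i < n] == b)%:R
       * (s == \sum_i (N i - f i))%N%:R.
  rewrite scaler_prod coefZ prodrXr coefXn scaler_prod.
  have -> : \prod_i 'X_i ^+ f i = 'X_[[multinom (f i : nat) | i < n]]
      :> {mpoly R[n]}.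
    by rewrite mpolyXE_id; apply: eq_bigr => i _; rewrite mnmE.
  case: (s == _); rewrite ?mulr1 ?mulr0 ?mcoeff0 //.
  by rewrite mcoeffZ mcoeffX.
rewrite (eq_bigr _ (fun i _ => factorE i)) bigA_distr_bigA /=.
rewrite coef_sum raddf_sum /= (eq_bigr _ (fun f _ => termE f)).
have [bN|] := boolP [forall i, b i <= N i]%N; last first.
  rewrite negb_forall => /existsP[i]; rewrite -ltnNge => Nb.
  rewrite [X in if _ then X else _](bigD1 i) //= bin_small // mulr0n mul0r if_same.
  apply: big1 => f _; have [E|] := eqVneq; last by rewrite mulr0 mul0r.
  rewrite (bigD1 i) //= /a; move/mnmP/(_ i): E; rewrite mnmE => ->.
  by rewrite bin_small // mulr0n !mul0r.
have {}bN i : (b i <= N i)%N by apply/forallP: i.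
pose g := [ffun i => inord (b i) : 'I_K.+1].
have gE i : g i = b i :> nat.
  by rewrite ffunE inordK // ltnS (leq_trans (bN i)).
rewrite (bigD1 g) //= [X in _ + X]big1 ?addr0 => [|f /eqP fg]; last first.
  have [E|] := eqVneq [multinom (f i : nat) | i < n] b; last by rewrite mulr0 mul0r.
  exfalso; apply: fg; apply/ffunP => i; apply/val_inj; rewrite /= gE.
  by move/mnmP/(_ i): E; rewrite mnmE.
have -> : [multinom (g i : nat) | i < n] == b.
  by apply/eqP/mnmP => i; rewrite mnmE gE.
have -> : (s == \sum_i (N i - g i))%N = (mdeg b + s == \sum_i N i)%N.
  rewrite (_ : \sum_i N i = mdeg b + \sum_i (N i - g i))%N ?eqn_add2l //.
  by rewrite mdegE -big_split; apply: eq_bigr => i _ /=; rewrite gE subnKC.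
rewrite mulr1; case: ifP => _; rewrite ?mulr1 ?mulr0 //.
by apply: eq_bigr => i _; rewrite gE.
Qed.

(** * Partial derivatives in [z_i] of polynomials in [x] *)

(** Differentiating each coefficient is the partial derivative in [z_i] with [x] held constant,
    hence a derivation. *)
Lemma map_mderivM (R : comNzRingType) n (i : 'I_n) (P Q : {poly {mpoly R[n]}}) :
  map_poly (mderiv i) (P * Q)
  = map_poly (mderiv i) P * Q + P * map_poly (mderiv i) Q.
Proof.
have cE (S : {poly {mpoly R[n]}}) s : (map_poly (mderiv i) S)`_s = (S`_s)^`M(i).
  by rewrite coef_map_id0 ?mderiv0.
apply/polyP => s; rewrite coefD cE !coefM raddf_sum /= -big_split /=.
by apply: eq_bigr => j _; rewrite !cE mderivM.
Qed.

Lemma map_mderivXsubX_exp (R : comNzRingType) n (i k : 'I_n) N :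
  map_poly (mderiv i) (('X - ('X_k)%:P) ^+ N)
  = (if i == k then - (('X - ('X_k)%:P) ^+ N.-1 *+ N) else 0)
  :> {poly {mpoly R[n]}}.
Proof.
elim: N => [|N IH].
  rewrite expr0 mulr0n oppr0 if_same -polyC1 map_polyC.
  by rewrite /= -mpolyC1 mderivC polyC0.
have XE : map_poly (mderiv i) ('X - ('X_k)%:P) = (if i == k then -1 else 0)
    :> {poly {mpoly R[n]}}.
  rewrite raddfB /= map_polyC /= mderivX mnm1E eq_sym.
  have -> : map_poly (mderiv i) 'X = 0 :> {poly {mpoly R[n]}}.
    apply/polyP => s; rewrite coef_map_id0 ?mderiv0 // coefX coef0.
    by case: (s == 1)%N; rewrite ?mderiv0 // -mpolyC1 mderivC.
  rewrite sub0r; have [->|] := eqVneq i k; last by rewrite scale0r polyC0 oppr0.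
  suff -> : (U_(k) - U_(k))%MM = 0%MM :> 'X_{1..n} by rewrite mpolyX0 scale1r.
  by apply/mnmP => j; rewrite mnmBE mnm0E subnn.
rewrite exprS map_mderivM XE IH; case: ifP => _; last by rewrite mul0r mulr0 addr0.
case: N {IH} => [|N]; first by rewrite !expr0 mulr0n oppr0 mulr0 addr0 mulr1.
by rewrite mulN1r mulrN mulrnAr -exprS -opprD -mulrS.
Qed.

Lemma map_mderiv_prod0 (R : comNzRingType) n (i : 'I_n) (J : Type) (r : seq J)
    (P : pred J) (f : J -> {poly {mpoly R[n]}}) :
  (forall j, P j -> map_poly (mderiv i) (f j) = 0) ->
  map_poly (mderiv i) (\prod_(j <- r | P j) f j) = 0.
Proof.
move=> f0; elim/big_rec: _ => [|j x Pj IH].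
  by rewrite -polyC1 map_polyC // /= -mpolyC1 mderivC polyC0.
by rewrite map_mderivM f0 // IH mul0r mulr0 addr0.
Qed.

(** * Hypergeometric vectors solve the KZ system *)

Lemma Ihyp_prod p n (M : 'I_n -> nat) l i :
  Ihyp p M l i
  = (\prod_(k < n) ('X - ('X_k)%:P) ^+ (M k - (k == i)))`_(l * p - 1).
Proof.
rewrite /Ihyp [in RHS](bigD1 i) //= eqxx.
congr ((polyseq (_ * _))`_ _); first by rewrite subn1.
by apply: eq_bigr => k /negbTE->; rewrite subn0.
Qed.

Lemma sum_decr_at n (M : 'I_n -> nat) i : (0 < M i)%N ->
  (\sum_k (M k - (k == i)) = (\sum_k M k).-1)%N.
Proof.
move=> Mi; rewrite (bigD1 i) //= [in RHS](bigD1 i) //= eqxx.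
rewrite (eq_bigr M) => [|k /negbTE->]; last by rewrite subn0.
by case: (M i) Mi => // x _; rewrite subn1.
Qed.

(** The shift by one in the index [l * p - 1] cancels the one in the total exponent, so the degree
    condition involves the full sum of the [M k]. *)
Lemma Ihyp_mcoeff p n (M : 'I_n -> nat) l i (b : 'X_{1..n}) :
  (0 < l * p)%N -> (0 < M i)%N ->
  (Ihyp p M l i)@_b = if (mdeg b + l * p == \sum_k M k)%N
    then \prod_k ((-1) ^+ b k *+ 'C(M k - (k == i), b k)) else 0.
Proof.
move=> lp Mi; rewrite Ihyp_prod prod_XsubX_coef sum_decr_at //.
have : (0 < \sum_k M k)%N by rewrite (bigD1 i) //= addn_gt0 Mi.
by move=> ?; congr (if _ then _ else _); lia.
Qed.

(** The differential equations come from the partial fractions of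
    [(z_i - z_k) / ((x - z_i) (x - z_k))]. The linear condition reflects that the derivative in [x]
    of the master polynomial has no term in [x^(l p - 1)] modulo [p]. *)
Lemma Ihyp_KZ_reduced p n (M : 'I_n -> nat) l :
  prime p -> (0 < l)%N -> (forall i, 0 < M i)%N ->
  KZ_reduced (fun i => (M i)%:R) (Ihyp p M l : pvec p n).
Proof.
move=> pp l0 M0; have lp : (0 < l * p)%N by rewrite muln_gt0 l0 prime_gt0.
split=> [i k ik|]; last first.
  apply/mpolyP => b; rewrite raddf_sum mcoeff0 /=.
  have [E|nE] := boolP (mdeg b + l * p == \sum_k M k)%N; last first.
    by apply: big1 => k _; rewrite mcoeffZ Ihyp_mcoeff // (negbTE nE) mulr0.
  pose T : 'F_p := \prod_k ((-1) ^+ b k *+ 'C(M k, b k)).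
  (* Here [M * 'C(M - 1, b) = (M - b) * 'C(M, b)] extracts the factor [T] common to all [k]; the
     remaining factors add up to [l * p], which is zero. *)
  have termE k : ((M k)%:R *: Ihyp p M l k)@_b = ((M k)%:R - (b k)%:R) * T.
    rewrite mcoeffZ Ihyp_mcoeff // E /T [in RHS](bigD1 k) //= (bigD1 k) //=.
    rewrite mulrA [RHS]mulrA; congr (_ * _); last first.
      by apply: eq_bigr => j /negbTE->; rewrite subn0.
    rewrite eqxx subn1 -[_ *+ 'C(_.-1, _)]mulr_natr -[_ *+ 'C(M k, _)]mulr_natr.
    rewrite [LHS]mulrCA [RHS]mulrCA; congr (_ * _).
    case: (leqP (b k) (M k)) => bM.
      by rewrite -natrB // -!natrM mul_bin_down.
    by rewrite !bin_small ?mulr0 //; lia.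
  rewrite (eq_bigr _ (fun k _ => termE k)) -mulr_suml sumrB -!natr_sum.
  by rewrite -(eqP E) mdegE natrD addrAC subrr add0r natrM pchar_Fp_0 // mulr0 mul0r.
have ki : k != i by rewrite eq_sym.
pose Psi : {poly Fpoly p n} := \prod_(j < n | (j != i) && (j != k))
  ('X - ('X_j)%:P) ^+ (M j).
have prodE a b : a != b -> Ihyp p M l a
    = (('X - ('X_a)%:P) ^+ (M a).-1 * (('X - ('X_b)%:P) ^+ M b
      * \prod_(j < n | (j != a) && (j != b)) ('X - ('X_j)%:P) ^+ (M j)))
      `_(l * p - 1) :> Fpoly p n.
  by move=> ab; rewrite /Ihyp (bigD1 b) //= eq_sym.
have kE := prodE k i ki; rewrite (eq_bigl (fun j => (j != i) && (j != k))) in kE;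
  last by move=> j; rewrite andbC.
have iE := prodE i k ik; rewrite -/Psi in iE kE.
set Q : {poly Fpoly p n} := _ * _ in kE.
(* With Phi the full product, this derivative is [- M_i] times Phi divided by
   [(x - z_i) (x - z_k)]. *)
have DQ : map_poly (mderiv i) Q
    = - ((M i)%:R * (('X - ('X_i)%:P) ^+ (M i).-1
        * (('X - ('X_k)%:P) ^+ (M k).-1 * Psi))).
  have D0 : map_poly (mderiv i) Psi = 0.
    apply: map_mderiv_prod0 => j /andP[ji _].
    by rewrite map_mderivXsubX_exp eq_sym (negbTE ji).
  have Dk : map_poly (mderiv i) (('X - ('X_k)%:P) ^+ (M k).-1 : {poly Fpoly p n}) = 0.
    by rewrite map_mderivXsubX_exp (negbTE ik).
  rewrite /Q map_mderivM Dk map_mderivM D0 map_mderivXsubX_exp eqxx.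
  have aux (A B C P X : {poly Fpoly p n}) N :
      0 * X + A * (- (B *+ N) * P + C * 0) = - (N%:R * (B * (A * P))).
    by ring.
  exact: aux.
have [x Mi] : exists x, M i = x.+1 by exists (M i).-1; rewrite prednK.
have [y Mk] : exists y, M k = y.+1 by exists (M k).-1; rewrite prednK.
have coefE (P Q' : {poly Fpoly p n}) u N s :
    u%:P * map_poly (mderiv i) P = N%:R * (P - Q') ->
    u * (P`_s)^`M(i) = N%:R *: (P`_s - Q'`_s).
  move/(congr1 (fun S : {poly _} => S`_s)).
  rewrite coefCM coef_map_id0 ?mderiv0 // => ->.
  by rewrite scaler_nat mulr_natl coefMn coefB.
rewrite kE iE; apply: coefE; rewrite DQ /Q Mi Mk polyCB /=.
have aux (X u v P N : {poly Fpoly p n}) :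
    (u - v) * - (N * ((X - u) ^+ x * ((X - v) ^+ y * P)))
    = N * ((X - v) ^+ y * ((X - u) ^+ x.+1 * P)
           - (X - u) ^+ x * ((X - v) ^+ y.+1 * P)).
  by rewrite !exprS; ring.
exact: aux.
Qed.

(** * The Frobenius subring and module structure on solutions *)

Lemma Frob_subring_mderiv p n (c : Fpoly p n) (i : 'I_n) :
  prime p -> in_Frob_subring c -> c^`M(i) = 0.
Proof.
move=> pp [c' ->]; rewrite comp_mpolyEX raddf_sum big1 //= => m _.
rewrite mderivZ comp_mpolyX.
have -> : \prod_(j < n) tnth [tuple ('X_i : Fpoly p n) ^+ p | i < n] j ^+ m j
    = 'X_[m *+ p] :> Fpoly p n.
  rewrite mpolyXE_id; apply: eq_bigr => j _.
  by rewrite tnth_mktuple mulmnE -exprM mulnC.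
by rewrite mderivX mulmnE natrM pchar_Fp_0 // mulr0 scale0r scaler0.
Qed.

Lemma Frob_subring0 p n : in_Frob_subring (0 : Fpoly p n).
Proof. by exists 0; rewrite comp_mpoly0. Qed.

Lemma Frob_subringD p n (c d : Fpoly p n) :
  in_Frob_subring c -> in_Frob_subring d -> in_Frob_subring (c + d).
Proof. by move=> [c' ->] [d' ->]; exists (c' + d'); rewrite comp_mpolyD. Qed.

Lemma Frob_subring_monomial p n (v : 'F_p) (m : 'X_{1..n}) :
  in_Frob_subring (v *: 'X_[m *+ p] : Fpoly p n).
Proof.
exists (v *: 'X_[m]); rewrite comp_mpolyZ comp_mpolyX mpolyXE_id.
congr (_ *: _); apply: eq_bigr => j _.
by rewrite tnth_mktuple mulmnE -exprM mulnC.
Qed.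

Lemma KZ_reduced0 (F : fieldType) n (mu : 'I_n -> F) :
  KZ_reduced mu (fun=> 0).
Proof.
split=> [i k _|]; first by rewrite mderiv0 mulr0 subrr scaler0.
by apply: big1 => i _; rewrite scaler0.
Qed.

(** A polynomial with zero partial derivatives passes through the equations like a scalar. *)
Lemma KZ_reduced_comb (F : fieldType) n (mu : 'I_n -> F)
    (I J : 'I_n -> {mpoly F[n]}) (c : {mpoly F[n]}) :
  (forall i, c^`M(i) = 0) -> KZ_reduced mu I -> KZ_reduced mu J ->
  KZ_reduced mu (fun k => I k + c * J k).
Proof.
move=> dc [I1 I2] [J1 J2]; split=> [i k ik|].
  rewrite mderivD mderivM dc mul0r add0r mulrDr mulrCA I1 // J1 //.
  by rewrite -scalerAr -scalerDr mulrBr; congr (_ *: _); ring.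
rewrite (eq_bigr (fun i => mu i *: I i + c * (mu i *: J i))) => [|i _].
  by rewrite big_split /= -mulr_sumr I2 J2 mulr0 addr0.
by rewrite scalerDr scalerAr.
Qed.

Lemma eq_KZ_reduced (F : fieldType) n (mu : 'I_n -> F)
    (I J : 'I_n -> {mpoly F[n]}) :
  I =1 J -> KZ_reduced mu I -> KZ_reduced mu J.
Proof.
move=> IJ [h1 h2]; split=> [i k ik|]; first by rewrite -!IJ h1.
by rewrite -[RHS]h2; apply: eq_bigr => i _; rewrite IJ.
Qed.

(** * Admissibility in terms of exponents modulo [p] *)

Lemma iter_mderiv_comb (R : comNzRingType) n (j : 'I_n) s
    (f g c : {mpoly R[n]}) :
  c^`M(j) = 0 ->
  iter s (mderiv j) (f + c * g) = iter s (mderiv j) f + c * iter s (mderiv j) g.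
Proof.
by move=> dc; elim: s => //= s ->; rewrite mderivD mderivM dc mul0r add0r.
Qed.

Lemma admissible0 p n (L : 'I_n -> nat) : admissible L (fun=> 0 : Fpoly p n).
Proof.
move=> j k; elim: (L j).+1 => //= s ->; exact: mderiv0.
Qed.

Lemma eq_admissible p n (L : 'I_n -> nat) (I J : pvec p n) :
  I =1 J -> admissible L I -> admissible L J.
Proof. by move=> IJ h j k; rewrite -IJ. Qed.

Lemma admissible_comb p n (L : 'I_n -> nat) (I J : pvec p n) (c : Fpoly p n) :
  (forall i, c^`M(i) = 0) -> admissible L I -> admissible L J ->
  admissible L (fun k => I k + c * J k).
Proof. by move=> dc hI hJ j k; rewrite iter_mderiv_comb // hI hJ mulr0 addr0. Qed.

Lemma iter_mderiv_eq0 (R : nzRingType) n (j : 'I_n) s (f : {mpoly R[n]}) :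
  (forall a : 'X_{1..n}, (s <= a j)%N -> f@_a = 0) -> iter s (mderiv j) f = 0.
Proof.
elim: s f => [|s IH] f f0; first by apply/mpolyP => a; rewrite mcoeff0 f0.
rewrite iterSr; apply: IH => a sa; rewrite mcoeff_mderiv f0 ?mul0rn //.
by rewrite mnmDE mnm1E eqxx addn1.
Qed.

(** Differentiating [s] times multiplies the coefficient by [a_j (a_j - 1) ... (a_j - s + 1)], whose
    factors are all nonzero modulo [p] when the residue of [a_j] is at least [s]. *)
Lemma iter_mderiv_mcoeff p n (j : 'I_n) s (f : Fpoly p n) (a : 'X_{1..n}) :
  prime p -> iter s (mderiv j) f = 0 -> (s <= a j %% p)%N -> f@_a = 0.
Proof.
move=> pp; elim: s f a => [|s IH] f a.
  by move=> /= -> _; rewrite mcoeff0.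
rewrite iterSr => f0 sa.
have aj : (0 < a j)%N by case: (a j) sa => //; rewrite mod0n.
pose b := (a - U_(j))%MM.
have bU : (b + U_(j))%MM = a.
  by apply: submK; apply/mnm_lepP => i; rewrite mnm1E; case: eqP => // <-.
have bj : a j = (b j).+1 by rewrite -bU mnmDE mnm1E eqxx addn1.
have := IH _ b f0; rewrite mcoeff_mderiv bU -bj => {}IH.
have sb : (s <= b j %% p)%N.
  move: sa; rewrite bj -[(b j).+1]addn1 -modnDml addn1; case: (ltnP (b j %% p).+1 p) => h.
    by rewrite modn_small.
  suff -> : (b j %% p).+1 = p by rewrite modnn.
  by apply/eqP; rewrite eqn_leq h ltn_pmod // prime_gt0.
move/eqP: (IH sb); rewrite -mulr_natr mulf_eq0 => /orP[/eqP //|].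
rewrite -(dvdn_pcharf (pchar_Fp pp)) /dvdn => /eqP E.
by rewrite E in sa.
Qed.

Lemma Ihyp_admissible p n (M : 'I_n -> nat) l :
  prime p -> (0 < l)%N -> (forall i, 0 < M i)%N ->
  admissible M (Ihyp p M l : pvec p n).
Proof.
move=> pp l0 M0 j k; apply: iter_mderiv_eq0 => a ja.
rewrite Ihyp_mcoeff //; last by rewrite muln_gt0 l0 prime_gt0.
rewrite [X in if _ then X else _](bigD1 j) //= bin_small; last by lia.
by rewrite mulr0n mul0r if_same.
Qed.

(** * Support of an admissible solution *)

Lemma natr_Fp_neq0 p x : prime p -> (0 < x < p)%N -> x%:R != 0 :> 'F_p.
Proof.
move=> pp /andP[x0 xp]; rewrite -(dvdn_pcharf (pchar_Fp pp)).
by apply/negP => /(dvdn_leq x0); rewrite leqNgt xp.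
Qed.

Lemma natr_Fp_mod p x : prime p -> (x %% p)%:R = x%:R :> 'F_p.
Proof.
move=> pp; rewrite [in RHS](divn_eq x p) natrD natrM pchar_Fp_0 //.
by rewrite mulr0 add0r.
Qed.

(* By [KZ_mcoeff_ratio], [M_k (I k)@_a] is proportional to [M_k - a_k], so the
   linear condition forces [sum_k (M_k - a_k)] to vanish modulo [p]. *)
Lemma KZ_support p n (M : 'I_n -> nat) (I : pvec p n) (k0 : 'I_n)
    (a : 'X_{1..n}) :
  prime p -> (2 <= n)%N -> (forall i, 0 < M i)%N -> (forall i, (M i).+1 < p)%N ->
  KZ_reduced (fun i => (M i)%:R) I -> admissible M I -> (I k0)@_a != 0 ->
  [/\ forall j, (a j %% p <= M j)%N,
      exists k, (a k %% p < M k)%N /\ (I k)@_a != 0 &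
      exists l, (1 <= l < ((\sum_i M i) %/ p).+1)%N
                /\ (\sum_j a j %% p + l * p = \sum_j M j)%N].
Proof.
move=> pp n2 M0 Mp hI adm nz.
have vanish j k (x : 'X_{1..n}) : (M j < x j %% p)%N -> (I k)@_x = 0.
  exact: iter_mderiv_mcoeff.
have M_neq0 i : (M i)%:R != 0 :> 'F_p.
  by apply: natr_Fp_neq0; rewrite // M0 /= ltnW.
have aM j : (a j %% p <= M j)%N.
  by rewrite leqNgt; apply: contra nz => /vanish->.
have diff_neq0 j : (a j %% p < M j)%N -> (M j)%:R - (a j)%:R != 0 :> 'F_p.
  move=> lt; have -> : (M j)%:R - (a j)%:R = (M j - a j %% p)%:R :> 'F_p.
    by rewrite (natrB _ (ltnW lt)) natr_Fp_mod.
  apply: natr_Fp_neq0 => //; rewrite subn_gt0 lt.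
  by rewrite (leq_ltn_trans (leq_subr _ _)) // ltnW.
(* Otherwise every residue equals [M]. Moving one unit from some [i != k0] to [k0] gives residue
   [M k0 + 1], still below [p] and excluded by admissibility; the closedness relation then kills the
   coefficient at [a]. *)
have [j aj] : exists j, (a j %% p < M j)%N.
  apply/existsP; apply: contraNT nz => /existsPn h.
  have top i : (a i %% p = M i)%N by apply/eqP; rewrite eqn_leq aM leqNgt h.
  have [i ik] : exists i : 'I_n, i != k0.
    apply/existsP; apply: contraLR n2 => /existsPn all0; rewrite -ltnNge ltnS.
    rewrite -[n]card_ord -(card1 k0); apply/subset_leq_card/subsetP => i _.
    by have /negPn := all0 i.
  have ai : (0 < a i)%N.
    by have := M0 i; rewrite -top; case: (a i) => //; rewrite mod0n.
  pose x := (a - U_(i))%MM.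
  have xU : (x + U_(i))%MM = a.
    by apply: submK; apply/mnm_lepP => l; rewrite mnm1E; case: eqP => // <-.
  have xi : a i = (x i).+1 by rewrite -xU mnmDE mnm1E eqxx addn1.
  have := KZ_mcoeff_closed i k0 x hI; rewrite xU -xi.
  rewrite [(I i)@_(x + _)](vanish k0); last first.
    rewrite mnmDE mnmBE !mnm1E eqxx (negbTE ik) subn0 -modnDml top addn1.
    by rewrite modn_small.
  rewrite mulr0 => /eqP; rewrite !mulf_eq0 (negbTE (M_neq0 k0)) /=.
  by rewrite -[(a i)%:R]natr_Fp_mod // top (negbTE (M_neq0 i)).
have ratio i : (M j)%:R * ((M i)%:R - (a i)%:R) * (I j)@_a
    = (M i)%:R * ((M j)%:R - (a j)%:R) * (I i)@_a.
  exact: KZ_mcoeff_ratio hI.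
have nzj : (I j)@_a != 0.
  apply: contra nz => /eqP E; have /esym/eqP := ratio k0.
  by rewrite E mulr0 !mulf_eq0 (negbTE (M_neq0 k0)) (negbTE (diff_neq0 _ aj)).
split=> //; first by exists j.
have sumM : (\sum_i M i)%:R = (\sum_i a i %% p)%:R :> 'F_p.
  have := congr1 (mcoeff a) hI.2; rewrite raddf_sum mcoeff0 /=.
  move/(congr1 ( *%R ((M j)%:R - (a j)%:R))).
  rewrite mulr0 mulr_sumr (eq_bigr (fun i => ((M i)%:R - (a i %% p)%:R)
    * ((M j)%:R * (I j)@_a))) => [|i _]; last first.
    rewrite natr_Fp_mod // mcoeffZ mulrA [_ * (M i)%:R]mulrC -ratio.
    by rewrite -!mulrA mulrCA.
  rewrite -mulr_suml sumrB => /eqP; rewrite !mulf_eq0.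
  rewrite (negbTE (M_neq0 j)) (negbTE nzj) !orbF subr_eq0 -!natr_sum.
  by move/eqP.
have lt : (\sum_i a i %% p < \sum_i M i)%N.
  rewrite (bigD1 j) //= [X in (_ < X)%N](bigD1 j) //= -addSn leq_add //.
  by apply: leq_sum.
have dvd : (p %| \sum_i M i - \sum_i a i %% p)%N.
  by rewrite (dvdn_pcharf (pchar_Fp pp)) natrB ?(ltnW lt) // sumM subrr.
(* The difference is a positive multiple of [p], hence [1 <= l]; being at most the sum of the [M i],
   it also gives the upper bound. *)
exists ((\sum_i M i - \sum_i a i %% p) %/ p)%N; split; last first.
  by rewrite divnK // subnKC // ltnW.
rewrite ltnS leq_div2r ?leq_subr // andbT divn_gt0 ?prime_gt0 //.
by rewrite dvdn_leq // subn_gt0.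
Qed.

(** Modulo [p] the multipliers in the relations do not see the shift by [c *+ p], so [zero_class]
    applies to each translated box. *)
Lemma KZ_zero_block p n (M : 'I_n -> nat) (I : pvec p n) (c b b' : 'X_{1..n})
    (k : 'I_n) :
  prime p -> (forall i, 0 < M i)%N -> (forall i, (M i).+1 < p)%N ->
  KZ_reduced (fun i => (M i)%:R) I ->
  (forall j, b j <= M j)%N -> (forall j, b' j <= M j)%N -> mdeg b = mdeg b' ->
  (b k < M k)%N -> (I k)@_(c *+ p + b) = 0 ->
  forall j, (I j)@_(c *+ p + b') = 0.
Proof.
move=> pp M0 Mp hI bM b'M bb' bk.
have castE (x : 'X_{1..n}) i : ((c *+ p + x)%MM i)%:R = (x i)%:R :> 'F_p.
  by rewrite mnmDE mulmnE natrD natrM pchar_Fp_0 // mulr0 add0r.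
apply: (@zero_class _ _ M (fun j x => (I j)@_(c *+ p + x))) => //.
- move=> i x /andP[x0 xM]; apply: natr_Fp_neq0; rewrite // x0 /=.
  by apply: leq_ltn_trans xM _; apply: ltnW.
- move=> i j x; have := KZ_mcoeff_closed i j (c *+ p + x) hI.
  by rewrite !addmA -![_.+1%:R]natr1 !castE.
- by move=> i j x; have := KZ_mcoeff_ratio i j (c *+ p + x) hI; rewrite !castE.
Qed.

(** * Cancelling one block at a time *)

Lemma prime_dvd_binN p N b :
  prime p -> (b <= N)%N -> (N < p)%N -> ~~ (p %| 'C(N, b))%N.
Proof.
move=> pp bN Np; have : ~~ (p %| N`!)%N.
  elim: N Np {bN} => [|N IH] Np; first by rewrite dvdn1 neq_ltn prime_gt1 ?orbT.
  by rewrite factS Euclid_dvdM // negb_or IH ?(ltnW Np) // andbT gtnNdvd.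
by apply: contra => pC; rewrite -(bin_fact bN) dvdn_mulr.
Qed.

(** The coefficient is a product of signs and binomials with upper entry below [p]. Strictness at
    [k] keeps the lowered binomial ['C(M k - 1, b k)] nonzero. *)
Lemma Ihyp_mcoeff_neq0 p n (M : 'I_n -> nat) l k (b : 'X_{1..n}) :
  prime p -> (0 < l)%N -> (forall i, 0 < M i)%N -> (forall i, (M i).+1 < p)%N ->
  (forall j, b j <= M j)%N -> (b k < M k)%N ->
  (mdeg b + l * p = \sum_k M k)%N ->
  (Ihyp p M l k)@_b != 0.
Proof.
move=> pp l0 M0 Mp bM bk E.
rewrite Ihyp_mcoeff //; last by rewrite muln_gt0 l0 prime_gt0.
rewrite E eqxx.
apply/prodf_neq0 => j _; rewrite -mulr_natr mulf_eq0 signr_eq0 /=.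
have bj : (b j <= M j - (j == k))%N.
  by have := bM j; case: eqVneq => [->|_]; lia.
rewrite -(dvdn_pcharf (pchar_Fp pp)) prime_dvd_binN //.
by have := Mp j; lia.
Qed.

(** One coefficient is cancelled by a multiple of a hypergeometric vector. The result is again a
    solution, so it vanishes on the whole block in that degree; the multiple has no terms elsewhere,
    hence no new support appears. *)
Lemma KZ_descent p n (M : 'I_n -> nat) (I : pvec p n) (k0 : 'I_n)
    (a0 : 'X_{1..n}) :
  prime p -> (2 <= n)%N -> (forall i, 0 < M i)%N -> (forall i, (M i).+1 < p)%N ->
  KZ_reduced (fun i => (M i)%:R) I -> admissible M I -> (I k0)@_a0 != 0 ->
  exists l d k a, [/\ (1 <= l < ((\sum_i M i) %/ p).+1)%N, in_Frob_subring d,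
    (I k)@_a != 0, (I k + d * Ihyp p M l k)@_a = 0 &
    forall j x, (I j)@_x = 0 -> (I j + d * Ihyp p M l j)@_x = 0].
Proof.
move=> pp n2 M0 Mp hI adm nz.
have [aM [k [ak nzk]] [l [lr E]]] := KZ_support pp n2 M0 Mp hI adm nz.
have l0 : (0 < l)%N by case/andP: lr.
pose c := [multinom (a0 j %/ p)%N | j < n].
pose b := [multinom (a0 j %% p)%N | j < n].
have bM j : (b j <= M j)%N by rewrite mnmE.
have bk : (b k < M k)%N by rewrite mnmE.
have aE : (c *+ p + b)%MM = a0.
  by apply/mnmP => j; rewrite mnmDE mulmnE !mnmE -divn_eq.
have bl : (mdeg b + l * p = \sum_j M j)%N.
  by rewrite -E mdegE; congr (_ + _)%N; apply: eq_bigr => j _; rewrite mnmE.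
have Ib := Ihyp_mcoeff_neq0 pp l0 M0 Mp bM bk bl.
(* The component [k] supplied by [KZ_support], possibly different from [k0], makes this denominator
   nonzero. *)
pose v := - ((I k)@_a0 / (Ihyp p M l k)@_b).
pose d : Fpoly p n := v *: 'X_[c *+ p].
have dF : in_Frob_subring d := Frob_subring_monomial v c.
have coefE (f : Fpoly p n) x : (d * f)@_x
    = v * (if (c *+ p <= x)%MM then f@_(x - c *+ p) else 0).
  by rewrite /d -scalerAl mcoeffZ ['X_[_] * _]mulrC mcoeffMXE.
have Jk : (I k + d * Ihyp p M l k)@_a0 = 0.
  rewrite mcoeffD coefE -{2 3}aE lem_addr addmC addmK.
  by rewrite /v mulNr divfK // subrr.
exists l, d, k, a0; split=> // j x Ijx.
rewrite mcoeffD Ijx add0r coefE; case: ifP => [cx|_]; last by rewrite mulr0.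
pose b' := (x - c *+ p)%MM; have xE : (c *+ p + b')%MM = x.
  by rewrite addmC submK.
have [->|nzb] := eqVneq (Ihyp p M l j)@_b' 0; first by rewrite mulr0.
have J := KZ_reduced_comb (fun i => Frob_subring_mderiv i pp dF) hI
  (Ihyp_KZ_reduced pp l0 M0).
have [b'l b'M] : (mdeg b' + l * p = \sum_k M k)%N /\ forall i, (b' i <= M i)%N.
  move: nzb; rewrite Ihyp_mcoeff //; last by rewrite muln_gt0 l0 prime_gt0.
  case: ifP => [/eqP b'l|_]; last by rewrite eqxx.
  move=> nzb; split=> // i; rewrite leqNgt; apply: contra nzb => Mb.
  by rewrite (bigD1 i) //= bin_small ?mulr0n ?mul0r //; lia.
have bb : mdeg b = mdeg b' by apply/eqP; rewrite -(eqn_add2r (l * p)) bl b'l.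
rewrite -{1}aE in Jk.
have := KZ_zero_block pp M0 Mp J bM b'M bb bk Jk j.
by rewrite xE mcoeffD Ijx add0r coefE cx.
Qed.

(** Induction on the total number of monomials in all components, which each descent step strictly
    lowers. *)
Lemma KZ_admissible_span p n (M : 'I_n -> nat) (I : pvec p n) :
  prime p -> (2 <= n)%N -> (forall i, 0 < M i)%N -> (forall i, (M i).+1 < p)%N ->
  KZ_reduced (fun i => (M i)%:R) I -> admissible M I ->
  exists c : nat -> Fpoly p n, (forall l, in_Frob_subring (c l)) /\
    forall k, I k = \sum_(1 <= l < ((\sum_i M i) %/ p).+1) c l * Ihyp p M l k.
Proof.
move=> pp n2 M0 Mp.
have [s] := ubnP (\sum_k size (msupp (I k)))%N.
elim: s => // s IH in I * => hs hI adm.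
have [/forallP I0|] := boolP [forall k, I k == 0].
  exists (fun=> 0); split=> [_|k]; first exact: Frob_subring0.
  by rewrite (eqP (I0 k)) big1 // => l _; rewrite mul0r.
rewrite negb_forall => /existsP[k0]; rewrite -msupp_eq0.
case Ek: (msupp (I k0)) => [//|a0 t] _.
have nz : (I k0)@_a0 != 0 by rewrite -mcoeff_msupp Ek mem_head.
have [l [d [k [a [lr dF nzk Jk sub]]]]] := KZ_descent pp n2 M0 Mp hI adm nz.
have l0 : (0 < l)%N by case/andP: lr.
have dd i : d^`M(i) = 0 by apply: Frob_subring_mderiv.
pose J j := I j + d * Ihyp p M l j.
have subJ j : {subset msupp (J j) <= msupp (I j)}.
  by move=> x; rewrite !mcoeff_msupp; apply: contra => /eqP/sub/eqP.
have [| | |c [cF cE]] := IH J.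
- move: hs; rewrite ltnS; apply: leq_trans.
  rewrite (bigD1 k) // [X in (_ < X)%N](bigD1 k) //= -addSn leq_add //.
    apply: (@uniq_leq_size _ (a :: msupp (J k))) => [|x] /=.
      by rewrite msupp_uniq mcoeff_msupp Jk eqxx.
    by rewrite inE => /orP[/eqP->|/subJ//]; rewrite mcoeff_msupp.
  by apply: leq_sum => j _; apply: uniq_leq_size (msupp_uniq _) (subJ j).
- exact: KZ_reduced_comb (Ihyp_KZ_reduced pp l0 M0).
- exact: admissible_comb (Ihyp_admissible pp l0 M0).
have NF : in_Frob_subring (- d).
  by case: dF => d' ->; exists (- d'); rewrite comp_mpolyN.
(* The multiple added in the descent is removed by correcting the single coefficient of index
   [l]. *)
exists (fun i => c i + (if i == l then - d else 0)); split=> [i|j].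
  by apply: Frob_subringD => //; case: ifP => // _; apply: Frob_subring0.
have -> : I j = J j - d * Ihyp p M l j by rewrite /J addrK.
rewrite cE (eq_bigr _ (fun i _ => mulrDl _ _ _)) big_split /=; congr (_ + _).
rewrite (bigD1_seq l) ?mem_index_iota ?iota_uniq //= eqxx big1 ?addr0 ?mulNr //.
by move=> i /negbTE->; rewrite mul0r.
Qed.

(** * Equality of the two modules *)

Theorem theorem8p2 (p q n : nat) (m M : 'I_n -> nat) :
  prime p -> prime q -> (2 <= n)%N -> (n < p)%N -> (q < p)%N ->
  (forall i, 0 < m i < q)%N ->
  (* M_i = least positive integer with M_i = -m_i q^{-1} mod p *)
  (forall i, 0 < M i)%N ->
  (forall i, (M i)%:R = - (m i)%:R / (q%:R : 'F_p)) ->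
  (forall i (k : nat), (0 < k)%N -> k%:R = - (m i)%:R / (q%:R : 'F_p) ->
                       (M i <= k)%N) ->
  let r := ((\sum_(i < n) M i) %/ p)%N in
  forall I : 'I_n -> {mpoly 'F_p[n]},
    (@KZ_solution p q n m I /\ @admissible p n M I) <->
    exists c : nat -> {mpoly 'F_p[n]},
      (forall l, @in_Frob_subring p n (c l)) /\
      (forall k, I k = \sum_(1 <= l < r.+1) c l * @Ihyp p n M l k).
Proof.
move=> pp pq n2 _ qp mq M0 ME Mmin r I.
have q0 : q%:R != 0 :> 'F_p by rewrite natr_Fp_neq0 // prime_gt0.
have Mn0 i : (M i)%:R != 0 :> 'F_p.
  have /andP[m0 mltq] := mq i.
  rewrite ME mulf_neq0 ?invr_eq0 // oppr_eq0.
  by rewrite natr_Fp_neq0 // m0 (ltn_trans mltq).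
(* Minimality against the residue of [M i] gives [M i < p]. If [M i = p - 1], then [m i] and [q]
   would agree modulo [p], against [0 < m i < q < p]. *)
have Mp i : ((M i).+1 < p)%N.
  have Mi0 : (0 < M i %% p)%N.
    rewrite lt0n; apply: contra (Mn0 i) => /eqP E.
    by rewrite -natr_Fp_mod // E.
  have Mip : (M i < p)%N.
    apply: leq_ltn_trans (ltn_pmod (M i) (prime_gt0 pp)).
    by apply: Mmin; rewrite ?natr_Fp_mod.
  rewrite ltn_neqAle Mip andbT; apply/eqP => E.
  have /andP[m0 mltq] := mq i.
  have : (q - m i)%:R = 0 :> 'F_p.
    rewrite natrB ?(ltnW mltq) //.
    have : (M i).+1%:R = 0 :> 'F_p by rewrite E pchar_Fp_0.
    rewrite -natr1 ME => /(congr1 ( *%R^~ q%:R)).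
    by rewrite mulrDl divfK // mul1r mul0r addrC.
  by apply/eqP; apply: natr_Fp_neq0; lia.
have red (J : pvec p n) : KZ_solution q m J <-> KZ_reduced (fun i => (M i)%:R) J.
  exact: (KZ_solution_reduced J q0 ME Mn0).
split=> [[/red hI adm]|[c [cF cE]]]; first exact: KZ_admissible_span.
(* For the converse, partial sums allow induction on the number of terms, starting from the zero
   vector. *)
pose S s k := \sum_(1 <= l < s.+1) c l * Ihyp p M l k.
suff [h1 h2] : KZ_reduced (fun i => (M i)%:R) (S r) /\ admissible M (S r).
  have SI k : S r k = I k by rewrite cE.
  by split; [apply/red; apply: eq_KZ_reduced SI _ | apply: eq_admissible SI _].
elim: r {cE} => [|s [h1 h2]].
  have S0 k : 0 = S 0 k by rewrite /S big_geq.
  split; first exact: eq_KZ_reduced S0 (KZ_reduced0 _).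
  apply: (eq_admissible S0); exact: admissible0.
have dc i : (c s.+1)^`M(i) = 0 by apply: Frob_subring_mderiv.
have SE k : S s k + c s.+1 * Ihyp p M s.+1 k = S s.+1 k.
  by rewrite /S [RHS]big_nat_recr.
split.
  apply: (eq_KZ_reduced SE); apply: (KZ_reduced_comb dc h1).
  exact: Ihyp_KZ_reduced.
apply: (eq_admissible SE); apply: (admissible_comb dc h2).
exact: Ihyp_admissible.
Qed.
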